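(* Let $(\mathbf r,\mathbf h)$ be a pattern, with $\mathbf r=(r_1,\dots,r_t)$ and $\mathbf h=(h_1,\dots,h_t)$, set $B=\sum_{j=1}^t h_j|r_j|$, and let $n\ge 2$ be an integer with $\gcd(n,r_1\cdots r_t)=1$. If $d$ is a positive divisor of $n$ with $d<n$, and $q=n/d$, then $$T^{(n;d)}_{\mathbf r,\mathbf h}(\alpha_{1,n},\dots,\alpha_{n-1,n})=\sum_{M=-B}^{B}\mathsf S_M(\mathbf r,\mathbf h)\,c_q(M).$$
   Context: A pattern $(\mathbf r,\mathbf h)$ consists of an integer $t\ge 1$, a tuple $\mathbf r=(r_1,\dots,r_t)$ of nonzero integers with $r_1=1$, and a tuple $\mathbf h=(h_1,\dots,h_t)$ of nonnegative integers. For $n\ge 2$ put $\Omega_n=\{1,\dots,n-1\}$ and $\alpha_{k,n}=\cos(2\pi k/n)$ for $k\in\Omega_n$. For an integer $r$ with $\gcd(r,n)=1$, let $\sigma_r:\Omega_n\to\Omega_n$ be the permutation determined by $\sigma_r(k)\equiv rk\pmod n$. For $d\mid n$, $d<n$, put $\mathcal O_d(n)=\{k\in\Omega_n:\gcd(k,n)=d\}$ and, when $\gcd(n,r_1\cdots r_t)=1$, $$T^{(n;d)}_{\mathbf r,\mathbf h}(x_1,\dots,x_{n-1})=\sum_{k\in\mathcal O_d(n)}\prod_{j=1}^t\bigl(2x_{\sigma_{r_j}(k)}\bigr)^{h_j}.$$ $\mathsf S_M(\mathbf r,\mathbf h)$ denotes the coefficient of $u^M$ in the Laurent polynomial $\prod_{j=1}^t(u^{r_j}+u^{-r_j})^{h_j}$.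 The Ramanujan sum is $c_q(M)=\sum_{u\in(\mathbb{Z}/q\mathbb{Z})^\ast}e^{2\pi i Mu/q}$. *)

(* Defs.v *)
From HB Require Import structures.
From mathcomp Require Import all_boot all_order all_algebra fraction.
From mathcomp Require Import boolp classical_sets reals topology normedtype trigo.
From mathcomp Require Import complex zify.
Set Implicit Arguments.
Unset Strict Implicit.
Unset Printing Implicit Defensive.
Import Order.TTheory GRing.Theory Num.Theory.
Local Open Scope ring_scope.

(* [r`_0] is the first entry r_1, and is 1 only if the tuple is nonempty. *)
Definition is_pattern (t : nat) (r : t.-tuple int) (h : t.-tuple nat) : Prop :=
  [/\ (1 <= t)%N, forall j : 'I_t, tnth r j != 0 & r`_0 = 1].

Definition Omega (n : nat) := {k : 'I_n | (0 < k)%N}.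

Definition Omega_val (n : nat) (k : Omega n) : nat := val (val k).
Coercion Omega_val : Omega >-> nat.

Definition alpha (R : realType) (n : nat) (k : Omega n) : R :=
  cos (2 * pi * k%:R / n%:R).

(* The default [k] is only used when [r] is not coprime to [n]: see [sigmaP]. *)
Definition sigma (n : nat) (r : int) (k : Omega n) : Omega n :=
  odflt k [pick l : Omega n | (l%:Z == r * k%:Z %[mod n%:Z])%Z].

Lemma Omega_inj (n : nat) (k l : Omega n) :
  (k%:Z == l%:Z %[mod n%:Z])%Z -> k = l.
Proof.
rewrite eqz_mod_dvd => kl; do 2 apply: val_inj.
have /= := ltn_ord (val k); have /= := ltn_ord (val l).
rewrite -[val (val k)]/(nat_of_ord (val k)).
move: kl; rewrite /Omega_val /=.
move: (nat_of_ord _) => a; move: (nat_of_ord _) => b.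
move=> /dvdzP[z ez] hb ha.
have [z0|z0] := eqVneq z 0; first by move: ez; rewrite z0; lia.
by exfalso; nia.
Qed.

Lemma sigmaP (n : nat) (r : int) (k : Omega n) : coprimez r n%:Z ->
  ((sigma r k)%:Z = r * k%:Z %[mod n%:Z])%Z.
Proof.
move=> rn; rewrite /sigma; case: pickP => [l /eqP //|none] /=; exfalso.
have k0 : (0 < k)%N := valP k.
have kn : (k < n)%N := ltn_ord (val k).
move: (k : nat) k0 kn none => a a0 an none.
have n0 : n%:Z != 0 by lia.
set m := (r * a%:Z %% n%:Z)%Z.
have m0 : 0 <= m by exact: modz_ge0.
have mn : m < n%:Z by apply: ltz_pmod; lia.
have mE : m = `|m|%N by lia.
have mpos : m != 0.
  apply/negP => /eqP/dvdz_mod0P.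
  rewrite Gauss_dvdzr; last by rewrite /coprimez gcdzC.
  by rewrite dvdzE /= => /dvdn_leq; lia.
have h1 : (`|m| < n)%N by move: mn mpos; rewrite {1 2}mE; lia.
have h2 : (0 < Ordinal h1)%N by rewrite /=; lia.
have := none (exist (fun i : 'I_n => (0 < i)%N) (Ordinal h1) h2).
by rewrite /Omega_val /= -mE /m modz_mod eqxx.
Qed.

Lemma sigma_inj (n : nat) (r : int) : coprimez r n%:Z -> injective (@sigma n r).
Proof.
move=> rn k l kl; apply: Omega_inj.
have := sigmaP k rn; rewrite kl sigmaP // => /esym/eqP.
by rewrite !eqz_mod_dvd -mulrBr Gauss_dvdzr // /coprimez gcdzC.
Qed.

Definition orbitO (n d : nat) : {set Omega n} := [set k : Omega n | gcdn k n == d].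

Definition Tsum (A : comPzRingType) (n d t : nat) (r : t.-tuple int)
    (h : t.-tuple nat) (x : Omega n -> A) : A :=
  \sum_(k in orbitO n d)
    \prod_(j < t) (2 * x (sigma (tnth r j) k)) ^+ tnth h j.

(* Laurent polynomials with integer coefficients are handled inside the field *)
(* of fractions of Z[u], where u is invertible.                               *)
Definition uvar : {fraction {poly int}} := tofrac ('X : {poly int}).

Definition laurent_expansion (f : {fraction {poly int}}) (c : int -> int)
    (N : nat) : Prop :=
  (forall M : int, (N < `|M|)%N -> c M = 0) /\
  f = \sum_(m < (N + N).+1) (c (m%:Z - N%:Z))%:~R * uvar ^ (m%:Z - N%:Z).

(* The coefficient of u^M in [f]; it does not depend on the expansion chosen  *)
(* ([laurent_coefE]), and [xget]'s default 0 is only used when [f] is not a    *)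
(* Laurent polynomial ([laurent_expansion_exists]).                           *)
Definition laurent_coef (f : {fraction {poly int}}) (M : int) : int :=
  xget 0 [set a : int | exists c N, laurent_expansion f c N /\ a = c M]%classic.

Lemma uvar_neq0 : uvar != 0.
Proof. by rewrite /uvar tofrac_eq0 polyX_eq0. Qed.

Lemma laurent_expansion_poly f c N :
  laurent_expansion f c N <->
  (forall M : int, (N < `|M|)%N -> c M = 0) /\
  f * uvar ^+ N = tofrac (\poly_(m < (N + N).+1) c (m%:Z - N%:Z)).
Proof.
have uN0 : uvar ^+ N != 0 by rewrite expf_neq0 ?uvar_neq0.
have -> : tofrac (\poly_(m < (N + N).+1) c (m%:Z - N%:Z)) =
    (\sum_(m < (N + N).+1) (c (m%:Z - N%:Z))%:~R * uvar ^ (m%:Z - N%:Z))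
      * uvar ^+ N.
  rewrite poly_def rmorph_sum mulr_suml; apply: eq_bigr => m _.
  rewrite -mul_polyC rmorphM rmorphXn /= -mulrA; congr (_ * _).
    by rewrite -[c _ in LHS]intz !rmorph_int.
  by rewrite !exprnP -expfzDr ?uvar_neq0// subrK.
by split=> -[cN fE]; split=> //; [rewrite -fE | exact: (mulIf uN0 fE)].
Qed.

Lemma laurent_coefE f c N (M : int) :
  laurent_expansion f c N -> laurent_coef f M = c M.
Proof.
move=> cN; rewrite /laurent_coef; case: xgetP; last first.
  by move=> /(_ (c M)) []; exists c, N.
move=> _ _ [c' [N' [/laurent_expansion_poly[c'N' e'] ->]]].
case/laurent_expansion_poly: cN => cN e.
have : (\poly_(m < (N' + N').+1) c' (m%:Z - N'%:Z)) * 'X^N =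
       (\poly_(m < (N + N).+1) c (m%:Z - N%:Z)) * 'X^N'.
  apply/eqP; rewrite -tofrac_eq !rmorphM !rmorphXn /= -e' -e.
  by rewrite mulrAC.
have [M0|M0] := ltrP (M + N%:Z + N'%:Z) 0; first by rewrite cN ?c'N' //; lia.
move=> /(congr1 (fun q : {poly int} => q`_(`|M + N%:Z + N'%:Z|))).
have shift (a : int -> int) (K L k : nat) (aK : forall M : int, (K < `|M|)%N -> a M = 0) :
    ((\poly_(m < (K + K).+1) a (m%:Z - K%:Z)) * 'X^L)`_k = a (k%:Z - K%:Z - L%:Z).
  rewrite coefMXn coef_poly; case: ltnP => kL; first by rewrite aK //; lia.
  by case: ltnP => kK; [congr (a _) | rewrite aK //]; lia.
rewrite !shift //; set x := c' _; set y := c _.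
have -> : x = c' M by congr (c' _); lia.
by have -> : y = c M by congr (c _); lia.
Qed.

Lemma laurent_expansion_exists (p : {poly int}) (N : nat) :
  exists c K, laurent_expansion (tofrac p / uvar ^+ N) c K.
Proof.
pose c (M : int) : int := if 0 <= M + N%:Z then p`_(`|M + N%:Z|) else 0.
have [s ps] : exists s : nat, (size p <= s)%N by exists (size p).
have p0 (i j : nat) : (s <= i)%N -> i = j -> p`_j = 0.
  by move=> si <-; rewrite nth_default // (leq_trans ps).
exists c, (N + s)%N; apply/laurent_expansion_poly; split.
  move=> M hM; rewrite /c; case: ifPn => // M0.
  by apply: (p0 (absz (M + N%:Z)%R)); lia.
rewrite exprD mulrA divfK ?expf_neq0 ?uvar_neq0 // -rmorphXn -rmorphM /=.
congr tofrac; apply/polyP => k; rewrite coefMXn coef_poly /c.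
case: (ltnP k s) => ks.
  by case: ifPn => // _; case: ifPn => // ?; lia.
case: ltnP => kK; first by case: ifPn => ?; [congr (p`_ _); lia | lia].
by apply: (p0 (k - s)%N); lia.
Qed.

Definition patternB (t : nat) (r : t.-tuple int) (h : t.-tuple nat) : nat :=
  (\sum_(j < t) tnth h j * `|tnth r j|)%N.

Definition Scoef (t : nat) (r : t.-tuple int) (h : t.-tuple nat) (M : int) : int :=
  laurent_coef
    (\prod_(j < t) (uvar ^ tnth r j + uvar ^ (- tnth r j)) ^+ tnth h j) M.

(* The complex exponential e^(iy) of a real y. *)
Definition expi (R : realType) (y : R) : R[i] := Complex (cos y) (sin y).

(* 'Z_1 is Z/2Z, whose only unit is 1, so the formula is also right for q = 1. *)
Definition ramanujan (R : realType) (q : nat) (M : int) : R[i] :=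
  \sum_(u : 'Z_q | u \is a GRing.unit)
    expi (2 * pi * M%:~R * (u : nat)%:R / q%:R).

(* Main.v *)
Require Import Defs.
From mathcomp Require Import all_boot all_order all_algebra reals complex.
From mathcomp Require Import trigo zify ring.
Import Order.TTheory GRing.Theory Num.Theory.
Local Open Scope ring_scope.
Local Open Scope complex_scope.

(** Put [zeta = exp(2 pi i / n)]. Coprimality of [r_j] with [n] gives
    [2 alpha_(sigma_(r_j)(k)) = z^(r_j) + z^(- r_j)] for [z = zeta^k], so each
    summand of [T] is the Laurent polynomial of the pattern evaluated at
    [zeta^k]. Expanding it in powers of [z], summing over the [k] with
    [gcd(k, n) = d] and substituting [k = d u] with [u] a unit modulo [q] turns
    each power [z^M] into the Ramanujan sum [c_q(M)]. *)

(* [u^B] times the Laurent polynomial of the pattern: [u^r + u^(- r)] depends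
   only on [|r|] and equals [(u^(2|r|) + 1) / u^|r|]. *)
Definition pattern_poly (t : nat) (r : t.-tuple int) (h : t.-tuple nat) :
    {poly int} :=
  \prod_(j < t) ('X^(`|tnth r j| + `|tnth r j|) + 1) ^+ tnth h j.

(** The factor for [j] has degree [2|r_j|], so degrees add up to at most [2B]; dividing by [u^B]
    leaves exponents from [-B] to [B] only. *)
Lemma size_pattern_poly (t : nat) (r : t.-tuple int) (h : t.-tuple nat) :
  (size (pattern_poly t r h) <= (patternB r h + patternB r h).+1)%N.
Proof.
rewrite /pattern_poly /patternB -big_split /=.
apply: (big_ind2 (fun (p : {poly int}) b => (size p <= b.+1)%N)).
- by rewrite size_poly1.
- move=> p a p' a' pa pa'.
  apply: leq_trans (size_polyMleq p p') _.
  by rewrite -subn1 leq_subLR add1n -addSn -addnS leq_add.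
- move=> j _; apply: leq_trans (size_poly_exp_leq _ _) _.
  rewrite ltnS -mulnDr mulnC leq_mul2l; apply/orP; right.
  rewrite -subn1 leq_subLR add1n; apply: leq_trans (size_polyD _ _) _.
  by rewrite size_polyXn size_poly1 geq_max leqnn.
Qed.

(** Multiplied by [z^B], both sides become the value of [pattern_poly] at [z]. The field is
    arbitrary because the identity serves twice: at [uvar] to identify the coefficients, and at
    powers of [zeta] to evaluate the summands of [Tsum]. *)
Lemma pattern_prod_expansion (F : fieldType) (z : F) (t : nat)
    (r : t.-tuple int) (h : t.-tuple nat) : z != 0 ->
  \prod_(j < t) (z ^ tnth r j + z ^ (- tnth r j)) ^+ tnth h j =
  \sum_(m < (patternB r h + patternB r h).+1)
    ((pattern_poly t r h)`_m)%:~R * z ^ (m%:Z - (patternB r h)%:Z).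
Proof.
move=> z0; apply: (mulIf (expf_neq0 (patternB r h) z0)).
transitivity (map_poly intr (pattern_poly t r h)).[z]; last first.
  rewrite (horner_coef_wide (n := (patternB r h + patternB r h).+1)); last first.
    exact: leq_trans (size_poly _ _) (size_pattern_poly t r h).
  rewrite mulr_suml; apply: eq_bigr => m _.
  by rewrite coef_map -mulrA !exprnP -expfzDr // subrK.
rewrite /pattern_poly rmorph_prod horner_prod /patternB -prodrXr -big_split /=.
apply: eq_bigr => j _.
rewrite rmorphXn rmorphD rmorph1 /= map_polyXn horner_exp hornerD hornerXn.
rewrite hornerC mulnC exprM -exprMn; congr (_ ^+ _).
(* The share [z^|r_j|] of [z^B] now sits inside each factor; the sign of [r_j] only decides which
   summand becomes 1. *)
case: (tnth r j) => a.
  by rewrite mulrDl /= !exprnP -!expfzDr // addNr expr0z PoszD.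
rewrite NegzE opprK mulrDl abszN /= !exprnP -!expfzDr // addNr expr0z.
by rewrite addrC PoszD.
Qed.

Lemma Scoef_pattern_poly (t : nat) (r : t.-tuple int) (h : t.-tuple nat)
    (m : nat) :
  Scoef r h (m%:Z - (patternB r h)%:Z) = (pattern_poly t r h)`_m.
Proof.
set B := patternB r h.
(* The guard gives 0 below [-B], where the absolute value would fold negative indices back onto
   genuine coefficients. *)
pose c (M : int) : int :=
  if 0 <= M + B%:Z then (pattern_poly t r h)`_(`|M + B%:Z|) else 0.
have cE (k : nat) : c (k%:Z - B%:Z) = (pattern_poly t r h)`_k.
  by rewrite /c subrK.
rewrite -cE; apply: (laurent_coefE (N := B)); split.
  move=> M BM; rewrite /c; case: ifP => // M0.
  rewrite nth_default //; apply: leq_trans (size_pattern_poly t r h) _.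
  by rewrite -/B; lia.
rewrite pattern_prod_expansion ?uvar_neq0 //.
by apply: eq_bigr => k _; rewrite cE.
Qed.

Lemma expiD (R : realType) (x y : R) : expi (x + y) = expi x * expi y.
Proof. by rewrite /expi cosD sinD; simpc; rewrite [sin x * _ + _]addrC. Qed.

Lemma expi0 (R : realType) : expi (0 : R) = 1.
Proof. by rewrite /expi cos0 sin0. Qed.

Lemma expi_neq0 (R : realType) (x : R) : expi x != 0.
Proof.
apply/eqP => x0; have := expiD R x (- x).
by rewrite subrr expi0 x0 mul0r => /eqP; rewrite oner_eq0.
Qed.

Lemma expiN (R : realType) (x : R) : expi (- x) = (expi x)^-1.
Proof.
apply: (mulIf (expi_neq0 R x)).
by rewrite -expiD addNr expi0 mulVf ?expi_neq0.
Qed.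

Lemma expi_exp (R : realType) (x : R) (a : int) : expi (a%:~R * x) = expi x ^ a.
Proof.
have nat_exp (m : nat) : expi (m%:R * x) = expi x ^+ m.
  elim: m => [|m IHm]; first by rewrite mul0r expi0 expr0.
  by rewrite -natr1 mulrDl mul1r expiD IHm exprSr.
case: a => m; first exact: nat_exp.
by rewrite NegzE mulrNz mulNr expiN -invr_expz nat_exp.
Qed.

Lemma expiDN (R : realType) (x : R) : expi x + expi (- x) = (2 * cos x)%:C.
Proof.
apply/eqP; rewrite eq_complex /= cosN sinN subrr eqxx andbT.
by rewrite mulr_natl mulr2n.
Qed.

Definition zeta (R : realType) (n : nat) : R[i] := expi (2 * pi / n%:R).

Lemma zeta_neq0 (R : realType) (n : nat) : zeta R n != 0.
Proof. exact: expi_neq0. Qed.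

Lemma zeta_exp (R : realType) (n : nat) (a : int) :
  zeta R n ^ a = expi (2 * pi * a%:~R / n%:R).
Proof. by rewrite /zeta -expi_exp; congr expi; ring. Qed.

Lemma zeta_unity (R : realType) (n : nat) : (0 < n)%N -> zeta R n ^ n%:Z = 1.
Proof.
move=> n0; rewrite zeta_exp -[n%:Z%:~R]/(n%:R) mulfK ?pnatr_eq0; last by lia.
by rewrite /expi mulr_natl cos2pi sin2pi.
Qed.

Lemma zeta_exp_mod (R : realType) (n : nat) (a b : int) : (0 < n)%N ->
  (a = b %[mod n%:Z])%Z -> zeta R n ^ a = zeta R n ^ b.
Proof.
move=> n0 ab.
have red (c : int) : zeta R n ^ c = zeta R n ^ (c %% n%:Z)%Z.
  rewrite {1}(divz_eq c n%:Z) [(_ %/ _)%Z * _]mulrC expfzDr ?zeta_neq0 //.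
  by rewrite -exprz_exp zeta_unity // exp1rz mul1r.
by rewrite red ab -red.
Qed.

(** Euler's formula for the cosine. Knowing [sigma r k] modulo [n] is enough, since exponents of
    [zeta] matter only modulo [n]. *)
Lemma alpha_sigma (R : realType) (n : nat) (r : int) (k : Omega n) :
  coprimez r n%:Z ->
  (2 * alpha R (sigma r k))%:C =
    (zeta R n ^ k%:Z) ^ r + (zeta R n ^ k%:Z) ^ (- r).
Proof.
move=> rn; have n0 : (0 < n)%N by have := ltn_ord (val k); lia.
rewrite /alpha -expiDN -[X in expi (2 * pi * X / _)]/((sigma r k)%:Z%:~R).
rewrite expiN -zeta_exp (zeta_exp_mod _ _ _ _ n0 (sigmaP k rn)).
by rewrite !exprz_exp mulrN -invr_expz [k%:Z * r]mulrC.
Qed.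

Lemma coprimez_prod_tnth (t : nat) (r : t.-tuple int) (n : int) (j : 'I_t) :
  coprimez n (\prod_(i < t) tnth r i) -> coprimez (tnth r j) n.
Proof.
by rewrite (bigD1 j) //= coprimezMr coprimez_sym => /andP[].
Qed.

(** With [n = q * d], [gcd(k, n) = d] holds exactly when [d] divides [k] and [k / d] is coprime to
    [q], so [k = d * u] is a bijection with the units modulo [q]. *)
Lemma sum_orbitO (A : comPzRingType) (n d : nat) (f : nat -> A) :
  (0 < d)%N -> (d %| n)%N -> (d < n)%N ->
  \sum_(k in orbitO n d) f (k : Omega n) =
  \sum_(u : 'Z_(n %/ d) | u \is a GRing.unit) f (d * u)%N.
Proof.
move=> d0 /dvdnP[q ->]; rewrite mulnK // => dn.
(* This makes ['Z_q] the residues modulo [q], with representatives below [q]. *)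
have q1 : (1 < q)%N by nia.
have uq (u : 'Z_q) : (u < q)%N by apply: leq_trans (ltn_ord u) _; rewrite Zp_cast.
have unitE (u : 'Z_q) : (u \is a GRing.unit) = coprime q u.
  by rewrite -unitZpE // natr_Zp.
pose g (k : Omega (q * d)) : 'Z_q := inZp (k %/ d).
have gE (k : Omega (q * d)) : g k = (k %/ d)%N :> nat.
  rewrite /= Zp_cast // modn_small // ltn_divLR //; exact: ltn_ord.
have orbitE (k : Omega (q * d)) : (k \in orbitO (q * d) d) =
    (d %| k)%N && coprime q (k %/ d).
  rewrite inE; apply/eqP/andP => [kd|[/dvdnP[a ->]]].
    have dk : (d %| k)%N by have := dvdn_gcdl k (q * d); rewrite kd.
    split=> //; rewrite /coprime gcdnC -(eqn_pmul2r d0) mul1n.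
    by rewrite muln_gcdl divnK // kd eqxx.
  by rewrite mulnK // -muln_gcdl gcdnC => /eqP ->; rewrite mul1n.
have gd (k : Omega (q * d)) : k \in orbitO (q * d) d -> k = (d * g k)%N :> nat.
  by rewrite orbitE gE => /andP[dk _]; rewrite [RHS]mulnC divnK.
have g_inj : {in orbitO (q * d) d &, injective g}.
  move=> k l /gd kE /gd lE kl; do 2 apply: val_inj.
  by rewrite -[LHS]/(nat_of_ord (val k)) -/(Omega_val k) kE kl -lE.
transitivity (\sum_(u in g @: orbitO (q * d) d) f (d * u)%N).
  by rewrite big_imset //; apply: eq_bigr => k /gd <-.
apply: eq_bigl => u; rewrite unitE; apply/imsetP/idP => [[k + ->]|qu].
  by rewrite orbitE gE => /andP[].
(* Since [gcd(q, 0) = q > 1], a unit is nonzero, so [d * u] lies in [Omega]. *)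
have u0 : (0 < u)%N.
  by case: (posnP u) qu => // ->; rewrite /coprime gcdn0; lia.
have du : (d * u < q * d)%N by rewrite mulnC ltn_pmul2r.
have du0 : (0 < Ordinal du)%N by rewrite /= muln_gt0 d0.
pose k : Omega (q * d) := exist (fun i : 'I_(q * d) => (0 < i)%N) _ du0.
have kd : (k %/ d)%N = u by rewrite /= mulKn.
exists k; first by rewrite orbitE kd qu dvdn_mulr.
by apply: val_inj; rewrite -[LHS]/(nat_of_ord u) -kd -gE.
Qed.

Theorem proposition4p9 (R : realType) (t : nat) (r : t.-tuple int)
    (h : t.-tuple nat) (n d : nat) :
  is_pattern r h ->
  (2 <= n)%N ->
  coprimez n%:Z (\prod_(j < t) tnth r j) ->
  (0 < d)%N -> (d %| n)%N -> (d < n)%N ->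
  (Tsum d r h (@alpha R n))%:C =
    \sum_(m < (patternB r h + patternB r h).+1)
      (Scoef r h (m%:Z - (patternB r h)%:Z))%:~R
        * ramanujan R (n %/ d) (m%:Z - (patternB r h)%:Z).
Proof.
move=> _ n2 rn d0 dn ltdn.
pose f (k : nat) := \prod_(j < t) ((zeta R n ^ k%:Z) ^ tnth r j
  + (zeta R n ^ k%:Z) ^ (- tnth r j)) ^+ tnth h j.
transitivity (\sum_(k in orbitO n d) f (k : Omega n)).
  rewrite /Tsum rmorph_sum; apply: eq_bigr => k _.
  rewrite rmorph_prod; apply: eq_bigr => j _.
  rewrite rmorphXn; congr (_ ^+ _).
  by apply: alpha_sigma; exact: coprimez_prod_tnth rn.
rewrite sum_orbitO // /ramanujan.
(* With the sum over units moved outside on the right, the two sides are compared unit by unit and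
   then exponent by exponent. *)
under [RHS]eq_bigr do rewrite mulr_sumr.
rewrite exchange_big /=; apply: eq_bigr => u _.
rewrite /f pattern_prod_expansion ?expfz_neq0 ?zeta_neq0 //.
apply: eq_bigr => m _; rewrite Scoef_pattern_poly exprz_exp zeta_exp.
congr (_ * expi _).
(* The angles agree: [d * u * M / n = M * u / q], because [n = q * d]. *)
have dR : d%:R != 0 :> R by rewrite pnatr_eq0; lia.
have qR : (n %/ d)%:R != 0 :> R by rewrite pnatr_eq0 -lt0n divn_gt0 // ltnW.
have nE : n%:R = (n %/ d)%:R * d%:R :> R by rewrite -natrM divnK.
rewrite nE PoszM !intrM -!pmulrn.
by field; rewrite dR qR.
Qed.
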